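(* Let $A$ be an alternative Cartan $*$-algebra with $\mathbb{S}_A\neq\varnothing$. Then $$\mathcal{R}(A)\le \mathcal{C}(A)\le \frac{\dim(A)}{2},$$ where $\mathcal{R}(A)$ is the reconstructing number of $A$, $\mathcal{C}(A)$ is the Cartan number of $A$, and $\dim(A)$ is the real dimension.
   Context: **Cartan $*$-algebras.** Let $n\ge 1$, let $\mathcal{P}(n)$ be the power set of $\{1,\dots,n\}$ and $K\triangle H:=(K\setminus H)\cup(H\setminus K)$. A Cartan algebra is a real (not necessarily associative) algebra $A$ with a fixed real vector basis $\{e_K\}_{K\in\mathcal{P}(n)}$ and a function $\sigma:\mathcal{P}(n)\times\mathcal{P}(n)\to\{-1,1\}$ such that $\sigma(K,\varnothing)=\sigma(\varnothing,K)=1$ and $e_Ke_H=\sigma(K,H)e_{K\triangle H}$ for all $K,H$. Thus $e_\varnothing=1$ is the unity, and $\mathbb{R}$ is identified with $\mathbb{R}1\subset A$. $A$ is alternative if $x(xy)=x^2y$ and $(xy)y=xy^2$ for all $x,y$. A $*$-involution is a real linear map $x\mapsto x^c$ with $(x^c)^c=x$, $(xy)^c=y^cx^c$ and $x^c=x$ for $x\in\mathbb{R}$. A Cartan $*$-algebra is a Cartan algebra endowed with a $*$-involution such that $e_{\{k\}}^c\in\{e_{\{k\}},-e_{\{k\}}\}$ for $k=1,\dots,n$. Set $\mathbb{S}_A:=\{J\in A: J^c=-J,\ J^2=-1\}$. **Systems of Cartan pairs.** For $L,M\in\mathcal{P}(n)$, $(e_L,e_M)$ is a Cartan pair if $e_Le_M\in\mathbb{S}_A$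 (equivalently $e_{L\triangle M}\in\mathbb{S}_A$). For a set $\mathcal{C}$ of pairs $(e_L,e_M)$, put $\mathcal{C}_1:=\{L:\exists M,\ (e_L,e_M)\in\mathcal{C}\}$ and $\mathcal{C}_2:=\{M:\exists L,\ (e_L,e_M)\in\mathcal{C}\}$. $\mathcal{C}$ is a system of Cartan pairs (SCP) of $A$ if all its elements are Cartan pairs, $\mathcal{C}_1\cup\mathcal{C}_2=\mathcal{P}(n)$ and $\mathcal{C}_1\cap\mathcal{C}_2=\varnothing$. The Cartan number is $\mathcal{C}(A):=\min\{\min\{|\mathcal{C}_1|,|\mathcal{C}_2|\}:\mathcal{C}\text{ is a SCP of }A\}$. **Slice regular functions.** For $J\in\mathbb{S}_A$ let $\mathbb{C}_J:=\{\alpha+\beta J:\alpha,\beta\in\mathbb{R}\}$, and let $Q_A:=\bigcup_{J\in\mathbb{S}_A}\mathbb{C}_J$. For $D\subset\mathbb{C}$ non-empty, open and invariant under complex conjugation, let $\Omega_D:=\{\alpha+\beta J:\alpha,\beta\in\mathbb{R},\ \alpha+i\beta\in D,\ J\in\mathbb{S}_A\}\subset Q_A$ (an open circular set). It is a circular slice domain if moreover $D$ is connected and $D\cap\mathbb{R}\ne\varnothing$. A stem function on $D$ is $F=F_1+\iota F_2:D\to A\otimes_{\mathbb{R}}\mathbb{C}$ ($\iota$ the imaginary unit of the second factor, $F_1,F_2:D\to A$) with $F_1(\bar z)=F_1(z)$, $F_2(\bar z)=-F_2(z)$. It induces the slice function $f=\mathcal{I}(F):\Omega_D\to A$, $f(\alpha+\beta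 J)=F_1(\alpha+i\beta)+JF_2(\alpha+i\beta)$. $f$ is slice regular if $F$ is of class $C^1$ and $\frac{\partial F}{\partial\alpha}+\iota\frac{\partial F}{\partial\beta}=0$. The real components of $f$ are the functions $f_K:\Omega_D\to\mathbb{R}$ with $f=\sum_K f_Ke_K$. **Reconstructing number.** $\mathcal{R}(A)$ is the minimum integer $\ell$ for which there is a subset $\mathcal{K}\subset\mathcal{P}(n)$ of cardinality $\ell$ such that, for each circular slice domain $\Omega\subset Q_A$ and each slice regular $f:\Omega\to A$, if $f_K$ is constant for each $K\in\mathcal{K}$, then $f$ is constant. *)

(* Defs.v *)
From HB Require Import structures.
From mathcomp Require Import all_boot all_order all_algebra.
From mathcomp Require Import all_classical all_reals all_analysis.
Set Implicit Arguments.
Unset Strict Implicit.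
Unset Printing Implicit Defensive.
Import Order.TTheory GRing.Theory Num.Theory.
Import numFieldNormedType.Exports.
Local Open Scope ring_scope.

(* {set 'I_n} plays the role of the power set of {1, ..., n}. *)
Definition symdiff (n : nat) (K H : {set 'I_n}) : {set 'I_n} :=
  ((K :\: H) :|: (H :\: K))%SET.

(* MathComp's algebras are associative, so the product is a plain bilinear
   map on a finite-dimensional vector space. *)
Record cartanAlgebra (R : realType) (n : nat) := CartanAlgebra {
  carrier :> vectType R;
  mul : {bilinear carrier -> carrier -> carrier};
  e : {set 'I_n} -> carrier;
  e_basis : basis_of fullv (codom e);
  sigma : {set 'I_n} -> {set 'I_n} -> R;
  sigmaE : forall K H, sigma K H = 1 \/ sigma K H = -1;
  sigma0r : forall K, sigma K finset.set0 = 1;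
  sigma0l : forall K, sigma finset.set0 K = 1;
  mul_e : forall K H, mul (e K) (e H) = sigma K H *: e (symdiff K H) }.

Definition one (R : realType) (n : nat) (A : cartanAlgebra R n) : A :=
  e A finset.set0.

Record cartanStarAlgebra (R : realType) (n : nat) := CartanStarAlgebra {
  base :> cartanAlgebra R n;
  conj : {linear base -> base};
  conjK : forall x, conj (conj x) = x;
  conjM : forall x y, conj (mul base x y) = mul base (conj y) (conj x);
  conj_real : forall a : R, conj (a *: one base) = a *: one base;
  conj_e1 : forall k : 'I_n,
    conj (e base [set k]%SET) = e base [set k]%SET \/
    conj (e base [set k]%SET) = - e base [set k]%SET }.

Definition alternative (R : realType) (n : nat) (A : cartanAlgebra R n) : Prop :=
  forall x y : A, mul A x (mul A x y) = mul A (mul A x x) y /\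
                  mul A (mul A x y) y = mul A x (mul A y y).

Definition is_min (S : set nat) (m : nat) : Prop :=
  S m /\ forall k : nat, S k -> (m <= k)%N.

Section CartanStar.
Variables (R : realType) (n : nat) (A : cartanStarAlgebra R n).
Local Notation PP := {set 'I_n}.

Definition sphere : set A := fun J => conj A J = - J /\ mul A J J = - one A.

Definition cartan_pair (L M : PP) : Prop := sphere (mul A (e A L) (e A M)).

(* A set of pairs (e_L, e_M) is encoded by the set of its index pairs (L, M). *)
Definition is_SCP (C : {set PP * PP}) : Prop :=
  [/\ forall L M, (L, M) \in C -> cartan_pair L M,
      (fst @: C :|: snd @: C = [set: PP])%SET &
      (fst @: C :&: snd @: C = finset.set0)%SET].

Definition is_cartan_number : nat -> Prop :=
  is_min (fun m => exists2 C : {set PP * PP},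
    is_SCP C & m = minn #|(fst @: C)%SET| #|(snd @: C)%SET|).

Definition component (K : PP) (x : A) : R :=
  coord (codom_tuple (e A)) (enum_rank K) x.

(* The complex plane is R * R, the pair (a, b) standing for a + ib. *)
Definition cconj (z : R * R) : R * R := (z.1, - z.2).

Definition slice_point (z : R * R) (J : A) : A := z.1 *: one A + z.2 *: J.

Definition circular_set (D : set (R * R)) : set A :=
  fun x => exists z J, [/\ D z, sphere J & x = slice_point z J].

Definition slice_domain (D : set (R * R)) : Prop :=
  [/\ (exists z, D z), open D, (forall z, D z -> D (cconj z)), connected D &
      exists a : R, D (a, 0)].

(* F1 + iota F2, with values in the complexification of A, is the pair
   (F1, F2); iota acts on A * A by (x, y) |-> (- y, x). *)
Definition iota (w : A * A) : A * A := (- w.2, w.1).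

(* A carries its topology of finite-dimensional real vector space, so that C^1
   regularity and partial derivatives are taken coordinatewise. D is open, so
   the values of F outside D are irrelevant. *)
Definition C1_on (D : set (R * R)) (F : R * R -> A) : Prop :=
  forall (K : PP) (v : R * R), v = (1, 0) \/ v = (0, 1) ->
  forall z, D z -> derivable (component K \o F) z v /\
                   {for z, continuous ('D_v (component K \o F))}.

Definition partial (v : R * R) (F : R * R -> A) (z : R * R) : A :=
  \sum_(K : PP) 'D_v (component K \o F) z *: e A K.

Definition stem_partial (v : R * R) (F1 F2 : R * R -> A) (z : R * R) : A * A :=
  (partial v F1 z, partial v F2 z).

Definition is_stem (D : set (R * R)) (F1 F2 : R * R -> A) : Prop :=
  forall z, D z -> F1 (cconj z) = F1 z /\ F2 (cconj z) = - F2 z.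

Definition stem_holomorphic (D : set (R * R)) (F1 F2 : R * R -> A) : Prop :=
  [/\ C1_on D F1, C1_on D F2 &
      forall z, D z ->
        stem_partial (1, 0) F1 F2 z + iota (stem_partial (0, 1) F1 F2 z) = 0].

Definition induced_by (D : set (R * R)) (F1 F2 : R * R -> A) (f : A -> A) : Prop :=
  forall z J, D z -> sphere J -> f (slice_point z J) = F1 z + mul A J (F2 z).

(* f is a function on circular_set D, extended arbitrarily to A. *)
Definition slice_regular (D : set (R * R)) (f : A -> A) : Prop :=
  exists F1 F2 : R * R -> A,
    [/\ is_stem D F1 F2, stem_holomorphic D F1 F2 & induced_by D F1 F2 f].

Definition constant_on (T : Type) (X : set A) (g : A -> T) : Prop :=
  exists c : T, forall x, X x -> g x = c.

Definition reconstructing (KK : {set PP}) : Prop :=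
  forall (D : set (R * R)) (f : A -> A),
    slice_domain D -> slice_regular D f ->
    (forall K, K \in KK -> constant_on (circular_set D) (component K \o f)) ->
    constant_on (circular_set D) f.

Definition is_reconstructing_number : nat -> Prop :=
  is_min (fun l => exists2 KK : {set PP}, reconstructing KK & l = #|KK|).

End CartanStar.

(* Main.v *)
From HB Require Import structures.
Require Import Defs.
From mathcomp Require Import all_boot all_order all_algebra.
From mathcomp Require Import all_classical all_reals all_analysis.
From mathcomp Require Import lra.
Set Implicit Arguments.
Unset Strict Implicit.
Unset Printing Implicit Defensive.
Import Order.TTheory GRing.Theory Num.Theory.
Import numFieldNormedType.Exports.
Local Open Scope classical_set_scope.
Local Open Scope ring_scope.

(** The second inequality says that systems of Cartan pairs exist: the two
    projections of such a system split the power set in two, and the smaller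
    one has at most half of its elements. To build one it suffices to have a
    basis element e_K in the sphere ([SCP_exists]). The conjugation is diagonal
    in the Cartan basis ([conj_e]), so that the real part of J J, for J in the
    sphere, is a signed sum of squares of coordinates of J; as it is -1, some
    anti-selfconjugate e_K squares to -1 ([sphere_basis]).

    For the first inequality, each projection of a system of Cartan pairs is
    shown to be reconstructing ([reconstructing_pairs]). The argument takes
    place on the stem function F1 + iota F2, coordinate by coordinate. If the
    K-component of f = F1 + J F2 is constant on all slices, comparing conjugate
    points shows that F1 has constant K-component and that J F2 has zero
    K-component for every J in the sphere. Multiplication by a basis element
    permutes the coordinates up to sign ([component_mul_e]), so J := e_L e_M
    carries the M-component of F2 to the L-component of J F2, up to sign: when
    the L-component of f is constant and (L, M) or (M, L) is a Cartan pair, the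
    M-component of F2 vanishes. Thus, for each index, F1 or F2 has a constant
    component; the Cauchy-Riemann equations ([cauchy_riemann]) cancel the
    partial derivatives of the other one, which is constant as the domain is
    connected ([zero_gradient_cst]). Finally F2, constant and odd, vanishes at
    a real point, hence everywhere, so f is the constant F1. *)

(** * Functions with vanishing partial derivatives *)

Section ZeroGradient.
Variable R : realType.

(** A directional derivative is the derivative of the restriction to a line;
    this gives access to the one-variable mean value theorem. *)
Lemma is_derive_line (V : normedModType R) (g : V -> R) (p v : V) (t : R) :
  derivable g (p + t *: v) v ->
  is_derive t (1 : R) (fun s : R => g (p + s *: v)) ('D_v g (p + t *: v)).
Proof.
have E : (fun h : R => h^-1 *:
      (((fun s : R => g (p + s *: v)) \o shift t) (h *: (1 : R))
        - g (p + t *: v))) =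
    (fun h : R => h^-1 *: ((g \o shift (p + t *: v)) (h *: v)
        - g (p + t *: v))).
  apply/funext => h /=; congr (_ *: (g _ - _)).
  by rewrite scalerDl addrCA [h *: 1]mulr1 addrC.
move=> dg; split; first by rewrite /derivable E.
by rewrite /derive E.
Qed.

Lemma segment_cst (V : normedModType R) (g : V -> R) (p v : V) (a b : R) :
  a <= b ->
  {in `[a, b], forall t, derivable g (p + t *: v) v} ->
  {in `[a, b], forall t, 'D_v g (p + t *: v) = 0} ->
  g (p + b *: v) = g (p + a *: v).
Proof.
move=> ab dg dg0; set h := fun t : R => g (p + t *: v).
have hD t : t \in `[a, b] -> is_derive t (1 : R) h 0.
  by move=> ts; rewrite -(dg0 _ ts); apply/is_derive_line/dg.
have hI t : t \in `]a, b[ -> is_derive t (1 : R) h 0.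
  by move=> /subset_itv_oo_cc/hD.
have hC : {within `[a, b]%classic, continuous h}.
  by apply: derivable_within_continuous => t /hD ht; exact: ex_derive.
have [c _ ] := MVT_segment ab hI hC.
by move/eqP; rewrite mul0r subr_eq0 => /eqP.
Qed.

Lemma radial_segment_cst (V : normedModType R) (g : V -> R) (p v : V) (s : R) :
  (forall t, `|t| <= `|s| ->
     derivable g (p + t *: v) v /\ 'D_v g (p + t *: v) = 0) ->
  g (p + s *: v) = g p.
Proof.
move=> H; rewrite -[in RHS](addr0 p) -(scale0r v).
have [s_ge0|/ltW s_le0] := leP 0 s.
  have I t : t \in `[0, s] -> `|t| <= `|s|.
    by rewrite in_itv /= => /andP[t0 ts]; rewrite !ger0_norm.
  by apply: segment_cst => // t /I/H[].
have I t : t \in `[s, 0] -> `|t| <= `|s|.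
  by rewrite in_itv /= => /andP[t0 ts]; rewrite !ler0_norm// lerN2.
by apply/esym/segment_cst => // t /I/H[].
Qed.

(** Balls of R * R are squares, so a point is reached from the center by a
    horizontal segment followed by a vertical one, both inside the ball. *)
Lemma ball_cst (g : R * R -> R) (z w : R * R) (r : R) :
  (forall v, v = (1, 0) \/ v = (0, 1) -> forall u, ball z r u ->
     derivable g u v /\ 'D_v g u = 0) ->
  ball z r w -> g w = g z.
Proof.
move=> H [/= zw1 zw2].
have r_gt0 : 0 < r by exact: le_lt_trans zw1.
have near0 (t c d : R) : `|t| <= `|d - c| -> `|c - d| < r -> `|c - (c + t)| < r.
  by move=> td cd; rewrite opprD addNKr normrN (le_lt_trans td)// distrC.
have -> : w = (z + (w.1 - z.1) *: (1, 0)) + (w.2 - z.2) *: (0, 1).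
  case: w z {H zw1 zw2} => [a b] [c d].
  by congr (_, _); rewrite /= ?[_ *: 1]mulr1 ?[_ *: 0]mulr0 ?addr0;
    rewrite addrC subrK.
rewrite radial_segment_cst; last first.
  move=> t tw; apply: (H (0, 1)); first by right.
  split; rewrite /= ?[_ *: 1]mulr1 ?[_ *: 0]mulr0 ?addr0.
    by apply: (near0 _ _ w.1).
  exact: near0 tw zw2.
apply: radial_segment_cst => t tw; apply: (H (1, 0)); first by left.
split; rewrite /= ?[_ *: 1]mulr1 ?[_ *: 0]mulr0 ?addr0.
  exact: near0 tw zw1.
by rewrite /ball /= subrr normr0.
Qed.

(** By [ball_cst], g is locally constant, so the level set of g through w and
    its complement are both open in D. *)
Lemma zero_gradient_cst (D : set (R * R)) (g : R * R -> R) :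
  open D -> connected D ->
  (forall v, v = (1, 0) \/ v = (0, 1) -> forall z, D z ->
     derivable g z v /\ 'D_v g z = 0) ->
  forall z w, D z -> D w -> g z = g w.
Proof.
move=> oD cD H z w Dz Dw.
have loc u : D u -> nbhs u [set u' | D u' /\ g u' = g u].
  move=> Du; have /nbhs_ballP[r /= r0 rD] := open_nbhs_nbhs (Logic.conj oD Du).
  apply/nbhs_ballP; exists r => //= u' uu'; split; first exact: rD.
  by apply: (ball_cst (r := r)) uu' => v vE u'' /rD; apply: H.
have op (P : set R) : open [set u | D u /\ P (g u)].
  rewrite openE => u [Du Pu]; apply: filterS (loc _ Du) => u' [Du' gE].
  by split=> //; rewrite gE.
suff : [set u | D u /\ g u = g w] = D.
  by move=> DE; move: Dz; rewrite -DE => -[].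
apply: cD; first by exists w.
  exists [set u | D u /\ g u = g w]; first exact: (op [set x | x = g w]).
  by apply/seteqP; split=> [u []|u []].
exists (~` [set u | D u /\ g u <> g w]).
  exact/open_closedC/(op [set x | x <> g w]).
apply/seteqP; split=> [u [Du gu]|u [Du /not_andP[]//]].
  by split=> // -[].
by move=> /contrapT.
Qed.

End ZeroGradient.

(** * The product in coordinates *)

Section Symdiff.
Variable n : nat.
Implicit Types K H : {set 'I_n}.

Lemma in_symdiff i K H : (i \in symdiff K H) = (i \in K) (+) (i \in H).
Proof. by rewrite !inE; case: (i \in K); case: (i \in H). Qed.

Lemma symdiffC K H : symdiff K H = symdiff H K.
Proof. by rewrite /symdiff finset.setUC. Qed.

Lemma symdiffK H : involutive (symdiff H).
Proof. by move=> K; apply/setP=> i; rewrite !in_symdiff addbA addbb. Qed.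

Lemma symdiffKr K H : symdiff (symdiff K H) H = K.
Proof. by rewrite symdiffC [symdiff K H]symdiffC symdiffK. Qed.

Lemma symdiff0 K : symdiff K finset.set0 = K.
Proof. by apply/setP=> i; rewrite in_symdiff inE addbF. Qed.

Lemma symdiff_eq0 K H : (symdiff K H == finset.set0) = (H == K).
Proof.
by rewrite -(inj_eq (can_inj (symdiffK K))) symdiffK symdiff0.
Qed.

End Symdiff.

Section CartanStarTheory.
Variables (R : realType) (n : nat) (A : cartanStarAlgebra R n).
Implicit Types (x y : A) (K H L M : {set 'I_n}).

Local Notation "x ** y" := (Defs.mul A x y) (at level 40).
Local Notation ee := (e A).
Local Notation cc := (@component R n A).

Fact component_is_linear K : linear (cc K : A -> R^o).
Proof. by move=> a x y; rewrite /component linearP. Qed.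

HB.instance Definition _ K :=
  GRing.isLinear.Build R A R^o *:%R (cc K) (component_is_linear K).

Lemma component_e K H : cc K (ee H) = (K == H)%:R.
Proof.
have /andP[_ fr] := e_basis A.
have -> : ee H = (codom_tuple ee)`_(enum_rank H).
  by rewrite /= codomE (nth_map H) ?nth_enum_rank // -cardE.
rewrite /component coord_free // (inj_eq enum_rank_inj).
by rewrite eq_sym.
Qed.

Lemma component_sum x : x = \sum_K cc K x *: ee K.
Proof.
rewrite {1}(coord_basis (X := codom_tuple ee) (e_basis A) (memvf x)).
rewrite (reindex_onto enum_rank enum_val) /=; last first.
  by move=> i _; exact: enum_valK.
rewrite (eq_bigl xpredT) => [|K]; last by rewrite enum_rankK eqxx.
apply: eq_bigr => K _; congr (_ *: _).
by rewrite codomE (nth_map K) ?nth_enum_rank // -cardE.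
Qed.

Lemma component_inj x y : (forall K, cc K x = cc K y) -> x = y.
Proof.
by move=> xy; rewrite (component_sum x) (component_sum y);
  apply: eq_bigr => K _; rewrite xy.
Qed.

Lemma dim_cartan : \dim (fullv : {vspace A}) = #|{set 'I_n}|.
Proof.
have bE : basis_of fullv (codom_tuple ee) := e_basis A.
by rewrite -(size_basis bE).
Qed.

Lemma sigma_neq0 K H : sigma A K H != 0.
Proof. by have [->|->] := sigmaE A K H; rewrite ?oppr_eq0 oner_eq0. Qed.

(** Left multiplication by a basis element permutes the coordinates up to sign:
    e_H e_L is a multiple of e_K exactly for L = symdiff H K. *)
Lemma component_mul_e K H x :
  cc K (ee H ** x) = sigma A H (symdiff H K) * cc (symdiff H K) x.
Proof.
rewrite {1}(component_sum x) linear_sumr linear_sum (bigD1 (symdiff H K)) //=.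
rewrite big1 ?addr0 => [|L LHK];
  rewrite linearZr /= linearZ /= mul_e linearZ /=.
  by rewrite component_e symdiffK eqxx [_ *: 1]mulr1 [LHS]mulrC.
rewrite component_e -(can_eq (symdiffK H)) symdiffK eq_sym (negbTE LHK).
by rewrite !scaler0.
Qed.

Lemma sphereN x : sphere x -> sphere (- x).
Proof.
case=> cx xx; split; first by rewrite linearN cx.
by rewrite linearNl linearNr opprK.
Qed.

Lemma cartan_pairP L M : cartan_pair A L M <-> sphere (ee (symdiff L M)).
Proof.
rewrite /cartan_pair mul_e.
have [->|->] := sigmaE A L M; rewrite ?scale1r ?scaleN1r //.
by split=> [/sphereN|/sphereN //]; rewrite opprK.
Qed.

(** Only the generators are assumed to be mapped to their opposites or to
    themselves; induction on the cardinality of K works because e_K is, up to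
    sign, the product of e_{k} and e_(K :\ k), and so is the product in the
    reverse order. *)
Lemma conj_e K : exists s : R, conj A (ee K) = s *: ee K.
Proof.
have [m] := ubnP #|K|; elim: m K => // m IH K Km.
have [->|[k kK]] := set_0Vmem K.
  by exists 1; rewrite -[ee _ in LHS]scale1r conj_real.
set H := (K :\ k)%SET.
have [t tE] : exists t : R, conj A (ee H) = t *: ee H.
  by apply: IH; move: Km; rewrite (cardsD1 k K) kK.
have KE : symdiff [set k]%SET H = K.
  apply/setP=> i; rewrite in_symdiff !inE.
  by case: eqP => [->|_] //; rewrite kK.
have [s sE] : exists s : R, conj A (ee [set k]%SET) = s *: ee [set k]%SET.
  by have [->|->] := conj_e1 A k; [exists 1|exists (- 1)];
     rewrite ?scale1r ?scaleN1r.
have := congr1 (conj A) (mul_e A [set k]%SET H).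
rewrite conjM sE tE linearZl /= linearZr /= mul_e KE symdiffC KE.
rewrite !scalerA => sE'.
exists ((sigma A [set k]%SET H)^-1 * (t * s * sigma A H [set k]%SET)).
by rewrite -scalerA sE' linearZZ scalerK // sigma_neq0.
Qed.

Lemma component_conj K x (s : R) :
  conj A (ee K) = s *: ee K -> cc K (conj A x) = s * cc K x.
Proof.
move=> sE; rewrite {1}(component_sum x) linear_sum linear_sum (bigD1 K) //=.
rewrite big1 ?addr0 => [|L LK].
  by rewrite linearZ linearZ /= sE linearZ /= component_e eqxx [_ *: 1]mulr1
             [LHS]mulrC.
have [t tE] := conj_e L.
rewrite linearZ linearZ /= tE linearZ /= component_e eq_sym (negbTE LK).
by rewrite !scaler0.
Qed.

(** Only the products e_K e_K contribute to the real part of a square. *)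
Lemma component_square x :
  cc finset.set0 (x ** x) = \sum_K sigma A K K * cc K x ^+ 2.
Proof.
rewrite {1}(component_sum x) linear_sumlz linear_sum /=; apply: eq_bigr => K _.
rewrite linearZl /= linearZ /= component_mul_e symdiff0.
by rewrite [LHS]mulrCA expr2.
Qed.

(** An element J of the sphere has only coordinates along basis elements e_K
    with e_K^c = - e_K, and the real part of J J = -1 is the sum of the squares
    of these coordinates weighted by the signs of the e_K e_K. One of these
    signs must be negative. *)
Lemma sphere_basis : (exists J : A, sphere J) -> exists K, sphere (ee K).
Proof.
case=> J [cJ JJ]; apply: contrapT => noK.
have : 0 <= cc finset.set0 (J ** J).
  rewrite component_square; apply: sumr_ge0 => K _.
  have [s1|sN1] := sigmaE A K K; first by rewrite s1 mul1r sqr_ge0.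
  (* A negative weight only occurs with a zero coordinate: otherwise e_K would
     be in the sphere. *)
  suff -> : cc K J = 0 by rewrite expr0n mulr0.
  have [s sE] := conj_e K.
  have := component_conj J sE; rewrite cJ linearN /= => /eqP.
  rewrite -subr_eq0 -opprD oppr_eq0 -{1}[cc K J]mul1r -mulrDl mulf_eq0.
  case/orP=> [/eqP s1|/eqP //]; exfalso; apply: noK; exists K; split.
    by rewrite sE -[s]addr0 -(subrr 1) addrA [s + 1]addrC s1 add0r scaleN1r.
  rewrite mul_e sN1 scaleN1r; congr (- ee _).
  by apply/eqP; rewrite symdiff_eq0.
rewrite JJ linearN /= component_e eqxx.
by rewrite oppr_ge0 leNgt ltr01.
Qed.

(** * Cartan systems *)

(** If e_K is in the sphere and k belongs to K, then L |-> symdiff L K swaps the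
    sets without k and the sets with k; its graph over the former is a system
    of Cartan pairs. *)
Lemma SCP_exists : (exists J : A, sphere J) ->
  exists C : {set {set 'I_n} * {set 'I_n}}, is_SCP A C.
Proof.
case/sphere_basis=> K sK.
have [k kK] : exists k, k \in K.
  apply/set0Pn/eqP => K0; case: sK => _; rewrite mul_e K0 symdiff0 sigma0r.
  rewrite scale1r => /(congr1 (cc finset.set0)).
  rewrite linearN /= component_e eqxx => /eqP.
  by rewrite -subr_eq0 opprK; apply/negP; rewrite -(natrD _ 1 1) pnatr_eq0.
pose C := [set LM : {set 'I_n} * {set 'I_n} |
            (k \notin LM.1) && (LM.2 == symdiff LM.1 K)]%SET.
have fstE : (fst @: C = [set L : {set 'I_n} | k \notin L])%SET.
  apply/setP=> L; rewrite inE; apply/imsetP/idP => [[[L' M]]|kL].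
    by rewrite inE => /andP[? _] ->.
  by exists (L, symdiff L K); rewrite // inE kL /=.
have sndE : (snd @: C = [set M : {set 'I_n} | k \in M])%SET.
  apply/setP=> M; rewrite inE; apply/imsetP/idP => [[[L M']]|kM].
    by rewrite inE /= => /andP[kL /eqP->] ->; rewrite in_symdiff kK (negbTE kL).
  by exists (symdiff M K, M); rewrite // inE in_symdiff kM kK /= symdiffKr.
exists C; split.
- move=> L M; rewrite inE /= => /andP[_ /eqP->].
  by apply/cartan_pairP; rewrite symdiffK.
- by rewrite fstE sndE; apply/setP=> L; rewrite !inE orNb.
- by rewrite fstE sndE; apply/setP=> L; rewrite !inE andNb.
Qed.

(** * Reconstruction *)

Lemma component_partial K v (F : R * R -> A) z :
  cc K (partial v F z) = 'D_v (cc K \o F) z.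
Proof.
rewrite /partial linear_sum (bigD1 K) //= big1 ?addr0 => [|L LK].
  by rewrite linearZ /= component_e eqxx [LHS]mulr1.
by rewrite linearZ /= component_e eq_sym (negbTE LK) scaler0.
Qed.

Lemma cauchy_riemann D (F1 F2 : R * R -> A) K z :
  stem_holomorphic D F1 F2 -> D z ->
  'D_(1, 0) (cc K \o F1) z = 'D_(0, 1) (cc K \o F2) z /\
  'D_(1, 0) (cc K \o F2) z = - 'D_(0, 1) (cc K \o F1) z.
Proof.
case=> _ _ CR Dz; have := CR z Dz.
rewrite /stem_partial /iota => /pair_equal_spec[/= /eqP E1 /eqP E2].
move: E1 E2; rewrite subr_eq0 addr_eq0 => /eqP E1 /eqP E2.
split.
  by have := congr1 (cc K) E1; rewrite !component_partial.
by have := congr1 (cc K) E2; rewrite linearN /= !component_partial.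
Qed.

Lemma derive_cst_on (D : set (R * R)) (g : R * R -> R) (c : R) v z :
  open D -> (forall w, D w -> g w = c) -> D z -> 'D_v g z = 0.
Proof.
move=> oD gc Dz; rewrite -(derive_cst c z v); apply: near_eq_derive.
by near=> w; apply: gc; near: w; exact: open_nbhs_nbhs (Logic.conj oD Dz).
Unshelve. all: by end_near. Qed.

(** This is the core of the first inequality. If K is in KK, constancy of the
    K-component of f on all the slices at once constrains both components of
    the stem function: F1 has constant K-component and J F2 has zero
    K-component for every J in the sphere. Choosing for J the basis element
    joining M outside KK to some L in KK turns the latter into the vanishing of
    the M-component of F2. Hence for every index one of the two components of
    the stem function is constant, so is the other by the Cauchy-Riemann
    equations, and F2 vanishes because it is odd and D meets the real axis. *)
Lemma reconstructing_pairs (KK : {set {set 'I_n}}) :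
  (exists J : A, sphere J) ->
  (forall M, M \notin KK -> exists2 L, L \in KK & sphere (ee (symdiff L M))) ->
  reconstructing A KK.
Proof.
move=> [J sJ] pairs D f [_ oD sD cD [a Da]] [F1 [F2 [stem hol ind]]] fcst.
have [C1 C2 _] := hol.
(* In the K-component of f, the values at alpha + beta I and alpha - beta I
   have half-sum F1 and half-difference I F2. *)
have F12 K : K \in KK -> exists c : R, forall z I, D z -> sphere I ->
    cc K (F1 z) = c /\ cc K (I ** F2 z) = 0.
  move=> /fcst[c fc]; exists c => z I Dz sI.
  have Dc := sD _ Dz; have [E1 E2] := stem _ Dz.
  have := fc (slice_point z I); rewrite /= ind // linearD /= => fz.
  have := fc (slice_point (cconj z) I); rewrite /= ind // E1 E2.
  rewrite linearNr linearB /= => fzc.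
  have {}fz : cc K (F1 z) + cc K (I ** F2 z) = c by apply: fz; exists z, I.
  have {}fzc : cc K (F1 z) - cc K (I ** F2 z) = c.
    by apply: fzc; exists (cconj z), I.
  by split; lra.
have F1cst K : K \in KK -> exists c : R, forall z, D z -> cc K (F1 z) = c.
  by move=> /F12[c cE]; exists c => z /cE/(_ sJ)[].
have F20 M z : M \notin KK -> D z -> cc M (F2 z) = 0.
  move=> /pairs[L LKK sLM] Dz; have [c /(_ _ _ Dz sLM)[_]] := F12 _ LKK.
  rewrite component_mul_e [symdiff _ L]symdiffC symdiffK => /eqP.
  by rewrite mulf_eq0 (negbTE (sigma_neq0 _ _)) => /eqP.
have cst K z w : D z -> D w ->
    cc K (F1 z) = cc K (F1 w) /\ cc K (F2 z) = cc K (F2 w).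
  have [/F1cst[c F1c]|KN] := boolP (K \in KK) => Dz Dw.
    split; first by rewrite !F1c.
    apply: (zero_gradient_cst (g := cc K \o F2)) Dz Dw => // v vE u Du.
    split; first by have [] := C2 K v vE u Du.
    have [E1 E2] := cauchy_riemann K hol Du.
    by case: vE => ->; rewrite -?E1 ?E2 ?(derive_cst_on _ oD F1c Du) ?oppr0.
  have F2c u : D u -> (cc K \o F2) u = 0 by exact: F20.
  split; last by rewrite !F20.
  apply: (zero_gradient_cst (g := cc K \o F1)) Dz Dw => // v vE u Du.
  split; first by have [] := C1 K v vE u Du.
  have [E1 E2] := cauchy_riemann K hol Du.
  case: vE => ->; rewrite ?E1 ?(derive_cst_on _ oD F2c Du) //.
  by apply: oppr_inj; rewrite -E2 (derive_cst_on _ oD F2c Du) oppr0.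
(* F2 is constant, and it is its own opposite at the real point a. *)
have F2z z : D z -> F2 z = 0.
  move=> Dz; apply: component_inj => K.
  have [_ ->] := cst K z _ Dz Da.
  have := congr1 (cc K) (stem _ Da).2.
  rewrite /cconj /= oppr0 linearN linear0 /=; lra.
exists (F1 (a, 0)) => _ [z [I [Dz sI ->]]].
rewrite ind // F2z // linear0r addr0.
by apply: component_inj => K; have [] := cst K z _ Dz Da.
Qed.

(** Both sides work, since the condition of being a Cartan pair is symmetric. *)
Lemma SCP_reconstructing (C : {set {set 'I_n} * {set 'I_n}}) :
  (exists J : A, sphere J) -> is_SCP A C ->
  reconstructing A (fst @: C)%SET /\ reconstructing A (snd @: C)%SET.
Proof.
move=> SA [Cp Cu _].
have cov M : (M \in (fst @: C)%SET) || (M \in (snd @: C)%SET).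
  by rewrite -finset.in_setU Cu inE.
split; apply: reconstructing_pairs => // M MN.
  have := cov M; rewrite (negbTE MN) /= => /imsetP[[L M'] LM /= ->].
  exists L; first by apply/imsetP; exists (L, M').
  exact/cartan_pairP/Cp.
have := cov M; rewrite (negbTE MN) orbF /= => /imsetP[[M' L] ML /= ->].
exists L; first by apply/imsetP; exists (M', L).
by rewrite symdiffC; apply/cartan_pairP/Cp.
Qed.

Lemma SCP_card (C : {set {set 'I_n} * {set 'I_n}}) : is_SCP A C ->
  (#|(fst @: C)%SET| + #|(snd @: C)%SET| = #|{set 'I_n}|)%N.
Proof. by case=> _ Cu Ci; rewrite -cardsUI Cu Ci cards0 addn0 cardsT. Qed.

End CartanStarTheory.

(** * The two inequalities *)

Lemma is_min_exists (S : set nat) : (exists k, S k) -> exists m, is_min S m.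
Proof.
move=> [k Sk]; have ex : exists k, `[< S k >] by exists k; apply/asboolP.
have [m /asboolP Sm mmin] := ex_minnP ex.
by exists m; split=> // j Sj; apply/mmin/asboolP.
Qed.

Theorem theorem1p3 (R : realType) (n : nat) (n_gt0 : (0 < n)%N)
    (A : cartanStarAlgebra R n) (A_alt : alternative A)
    (SA_neq0 : exists J : A, sphere J) :
  exists r c : nat,
    [/\ is_reconstructing_number A r, is_cartan_number A c, (r <= c)%N &
        c%:R <= (\dim (fullv : {vspace A}))%:R / 2 :> R].
Proof.
have [C0 C0P] := SCP_exists SA_neq0.
have [c cP] : exists c, is_cartan_number A c.
  by apply: is_min_exists; eexists; exists C0.
have [[C CP cE] _] := cP.
have [rec1 rec2] := SCP_reconstructing SA_neq0 CP.
have [r rP] : exists r, is_reconstructing_number A r.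
  by apply: is_min_exists; eexists; exists (fst @: C)%SET.
exists r, c; split=> //.
  have [_ rmin] := rP.
  rewrite cE leq_min; apply/andP; split; apply: rmin.
    by exists (fst @: C)%SET.
  by exists (snd @: C)%SET.
rewrite ler_pdivlMr // -natrM ler_nat dim_cartan -(SCP_card CP) muln2 -addnn.
by rewrite cE leq_add ?geq_minl ?geq_minr.
Qed.
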